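(* Let $$u_n=p+(1-p)e^{-in\theta},\qquad 0\le p\le1,\ \theta\in\mathbb R,$$ and, for $N\ge1$, define $$\mathfrak B_N(u)=\sum_{n=1}^Nn^3|u_n|^2+\sum_{a,b\ge1,\; a+b\le N}(a+b)(a^2+ab+b^2)\,\mathrm{Re}\bigl(u_au_b\overline{u_{a+b}}\bigr).$$ Then $\mathfrak B_N(u)\ge0$ for every $N\ge1$. Consequently, if $\mathfrak b_N=\mathfrak B_N-\mathfrak B_{N-1}$, with $\mathfrak B_0=0$, then $$\sum_{N\ge1}\mathfrak b_Nx^N=(1-x)\sum_{N\ge1}\mathfrak B_Nx^N\ge0,\qquad 0<x<1.$$ *)

(* Defs.v *)
From mathcomp Require Import all_boot all_order all_algebra.
From mathcomp Require Import complex.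
From mathcomp Require Import all_classical all_reals all_analysis.

Set Implicit Arguments.
Unset Strict Implicit.
Unset Printing Implicit Defensive.

Import Order.TTheory GRing.Theory Num.Theory.
Import numFieldNormedType.Exports.

Local Open Scope ring_scope.

Definition cexp (R : realType) (z : R[i]) : R[i] :=
  (expR (complex.Re z))%:C%C * (cos (complex.Im z) +i* sin (complex.Im z))%C.

Definition useq (R : realType) (p theta : R) (n : nat) : R[i] :=
  p%:C%C + (1 - p)%:C%C * cexp (- ('i%C * n%:R * theta%:C%C)).

(* For N = 0 all the sums are empty, so that frakB u 0 = 0. *)
Definition frakB (R : realType) (u : nat -> R[i]) (N : nat) : R :=
  \sum_(1 <= n < N.+1) n%:R ^+ 3 * ComplexField.Normc.normc (u n) ^+ 2
  + \sum_(1 <= a < N.+1) \sum_(1 <= b < N.+1 | (a + b <= N)%N)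
      (a%:R + b%:R) * (a%:R ^+ 2 + a%:R * b%:R + b%:R ^+ 2)
      * complex.Re (u a * u b * ((u (a + b)%N)^*)%C).

(* Only meant for 1 <= N. *)
Definition frakb (R : realType) (u : nat -> R[i]) (N : nat) : R :=
  frakB u N - frakB u N.-1.

(* Main.v *)
Require Import Defs.
From mathcomp Require Import all_boot all_order all_algebra.
From mathcomp Require Import complex.
From mathcomp Require Import all_classical all_reals all_analysis.
From mathcomp Require Import ring lra zify.

Import Order.TTheory GRing.Theory Num.Theory.
Import numFieldNormedType.Exports.

Local Open Scope classical_set_scope.
Local Open Scope ring_scope.

(** The triple products collapse: with [t = p (1 - p)] and [c n = cos (n theta)],
    [|u_n|^2 = 1 - 2 t (1 - c n)] and
    [Re (u_a u_b conj(u_(a+b))) = 1 - t ((1 - c a) + (1 - c b) + (1 - c (a + b)))].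
    So [frakB] is affine in [t], which ranges over [0, 1/4].  It is a sum of
    nonnegative terms at [t = 0], and everything reduces to [t = 1/4], that is to
    [p = 1/2] ([frakB_useqE]).

    There the double sum can be evaluated: after collecting the coefficient of
    each cosine, the quartic terms cancel and, with [K = N (N + 1)],
    [4 frakB = K (K (N + 2) / 6 + sum_m f(m) c m)] where
    [f(m) = K / 2 - (2 N + 1) m / 3 + m^2] ([linformE]).  Since [f] is quadratic
    in [m], summation by parts gives a closed form.  Put [phi = theta / 2],
    [M = 2 N + 1], [x = M phi], [s = sin phi] and [y = M s]; then [48 s^3] times
    the cosine polynomial equals
    [y (y^2 + 4 - s^2) + 8 y cos phi cos x + (5 y^2 - 12 + 3 s^2) sin x]
    ([trigpoly_closed]).

    The parity and periodicity of the cosines allow [0 <= phi <= pi/2].  If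
    [N theta <= pi/2], each term of the cosine polynomial is nonnegative.
    Otherwise the closed form is nonnegative for [M >= 7]
    ([closed_form_ge0]): when [y^2 >= 12] the constant term dominates the
    amplitude of the oscillating part, and when [y^2 < 12] the angle [phi] is
    below [pi/6], so that [x] is at most [(pi/3) y] and elementary bounds on
    [cos x] and [sin x] are enough.  The cases [N = 1, 2] are direct.

    For the generating functions, [frakB] grows polynomially, so its power series
    converges on [0, 1) and its terms tend to [0]; Abel summation relates the
    partial sums of the two series up to such a term. *)

(** * Reduction to a cosine polynomial *)

Lemma useqE (R : realType) (p theta : R) (n : nat) :
  useq p theta n = ((p + (1 - p) * cos (n%:R * theta))
                    +i* (- ((1 - p) * sin (n%:R * theta))))%C.
Proof.
have arg : - ('i%C * n%:R * theta%:C%C) = (0 +i* (- (n%:R * theta)))%C :> R[i].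
  by rewrite -[n%:R](rmorph_nat (real_complex R)); simpc.
by rewrite /useq /cexp arg /= expR0 cosN sinN; simpc.
Qed.

Lemma useq_normc2 (R : realType) (p theta : R) (n : nat) :
  ComplexField.Normc.normc (useq p theta n) ^+ 2
  = 1 - 2 * (p * (1 - p)) * (1 - cos (n%:R * theta)).
Proof.
rewrite useqE /ComplexField.Normc.normc sqr_sqrtr; last first.
  by rewrite addr_ge0 ?sqr_ge0.
rewrite sqrrN exprMn sin2cos2; ring.
Qed.

Lemma useq_triple (R : realType) (p theta : R) (a b : nat) :
  complex.Re (useq p theta a * useq p theta b * ((useq p theta (a + b)%N)^*)%C)
  = 1 - p * (1 - p) * ((1 - cos (a%:R * theta)) + (1 - cos (b%:R * theta))
                       + (1 - cos ((a + b)%:R * theta))).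
Proof.
rewrite !useqE natrD [(_ + _) * theta]mulrDl cosD sinD /=.
have Ea := sin2cos2 (a%:R * theta); have Eb := sin2cos2 (b%:R * theta).
ring: Ea Eb.
Qed.

Lemma sum_antidiagonal_recr (R : nmodType) (g : nat -> nat -> R) (N : nat) :
  \sum_(1 <= a < N.+2) \sum_(1 <= b < N.+2 | (a + b <= N.+1)%N) g a b
  = \sum_(1 <= a < N.+1) \sum_(1 <= b < N.+1 | (a + b <= N)%N) g a b
    + \sum_(1 <= a < N.+1) g a (N.+1 - a)%N.
Proof.
rewrite big_nat_recr //= [X in _ + X]big_nat_cond [X in _ + X]big_pred0 ?addr0;
  last by move=> b; lia.
rewrite -big_split /=; apply: eq_big_nat => a /andP[a1 aN].
rewrite big_mkcond big_nat_recr //= [X in _ + X]ifF ?addr0; last lia.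
rewrite [in RHS]big_mkcond /=.
transitivity (\sum_(1 <= b < N.+1) ((if (a + b <= N)%N then g a b else 0)
   + (if b == (N.+1 - a)%N then g a b else 0))).
  apply: eq_big_nat => b /andP[b1 bN].
  have [le|gt] := leqP (a + b) N; first by rewrite ifT ?ifF ?addr0 //; lia.
  have [->|neq] := eqVneq b (N.+1 - a)%N; first by rewrite ifT ?add0r //; lia.
  by rewrite ifF ?addr0 //; lia.
rewrite big_split /=; congr (_ + _).
by rewrite -big_mkcond big_nat1_eq ifT //; lia.
Qed.

Lemma sum_quadratic (R : numFieldType) (A B C : R) (N : nat) :
  \sum_(1 <= a < N.+1) (A + B * a%:R + C * a%:R ^+ 2)
  = A * N%:R + B * (N%:R * (N%:R + 1) / 2)
    + C * (N%:R * (N%:R + 1) * (2 * N%:R + 1) / 6).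
Proof.
elim: N => [|N IH]; first by rewrite big_nil; ring.
by rewrite big_nat_recr // IH -natr1 /=; field.
Qed.

(** Four times [frakB] at [p = 1/2], where [4 |u_n|^2 = 2 (1 + c n)] and
    [4 Re (u_a u_b conj(u_(a+b))) = 1 + c a + c b + c (a + b)].  The sequence [c]
    is kept arbitrary, since collecting its coefficients uses no trigonometry. *)
Definition linform {R : realType} (c : nat -> R) (N : nat) : R :=
  \sum_(1 <= n < N.+1) 2 * n%:R ^+ 3 * (1 + c n)
  + \sum_(1 <= a < N.+1) \sum_(1 <= b < N.+1 | (a + b <= N)%N)
      (a%:R + b%:R) * (a%:R ^+ 2 + a%:R * b%:R + b%:R ^+ 2)
      * (1 + c a + c b + c (a + b)%N).

Definition profile {R : realType} (N : nat) (m : R) : R :=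
  N%:R * (N%:R + 1) / 2 - (2 * N%:R + 1) / 3 * m + m ^+ 2.

Definition trigpoly {R : realType} (c : nat -> R) (N : nat) : R :=
  N%:R * (N%:R + 1) * (N%:R + 2) / 6
  + \sum_(1 <= m < N.+1) profile N m%:R * c m.

(** By induction on [N]: the antidiagonal [a + b = n] is symmetric, so it
    contributes each [c a] twice with weight [n (n^2 - n a + a^2)], which is
    half the increment at [a] of the coefficient [K f(a)].  The coefficient of
    the last cosine and the constant term follow from power sums. *)
Lemma linformE (R : realType) (c : nat -> R) (N : nat) :
  linform c N = N%:R * (N%:R + 1) * trigpoly c N.
Proof.
elim: N => [|N IH]; first by rewrite /linform !big_nil; ring.
have -> : linform c N.+1 = linform c N + 2 * N.+1%:R ^+ 3 * (1 + c N.+1)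
    + \sum_(1 <= a < N.+1) N.+1%:R * (N.+1%:R ^+ 2 - N.+1%:R * a%:R + a%:R ^+ 2)
      * (1 + c N.+1 + c a + c (N.+1 - a)%N).
  rewrite /linform sum_antidiagonal_recr big_nat_recr //=.
  rewrite -!addrA; congr (_ + _); rewrite addrCA; congr (_ + _).
  congr (_ + _); apply: eq_big_nat => a /andP[a1 aN].
  rewrite subnKC; last lia.
  by rewrite natrB; [ring | lia].
set n := N.+1%:R : R.
transitivity (linform c N + 2 * n ^+ 3 * (1 + c N.+1)
    + (1 + c N.+1) * \sum_(1 <= a < N.+1)
         (n ^+ 3 + (- n ^+ 2) * a%:R + n * a%:R ^+ 2)
    + \sum_(1 <= a < N.+1) 2 * n * (n ^+ 2 - n * a%:R + a%:R ^+ 2) * c a).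
  rewrite -[RHS]addrA; congr (_ + _).
  (* Exchanging a and b identifies the two families of cosines. *)
  have rev : \sum_(1 <= a < N.+1) n * (n ^+ 2 - n * a%:R + a%:R ^+ 2) * c a
    = \sum_(1 <= a < N.+1) n * (n ^+ 2 - n * a%:R + a%:R ^+ 2)
        * c (N.+1 - a)%N.
    rewrite big_nat_rev /=; apply: eq_big_nat => a /andP[a1 aN].
    have -> : (1 + N.+1 - a.+1 = N.+1 - a)%N by lia.
    by rewrite natrB ?/n; [ring | lia].
  transitivity (\sum_(1 <= a < N.+1) ((1 + c N.+1) *
       (n ^+ 3 + (- n ^+ 2) * a%:R + n * a%:R ^+ 2)
       + (n * (n ^+ 2 - n * a%:R + a%:R ^+ 2) * c a)
       + n * (n ^+ 2 - n * a%:R + a%:R ^+ 2) * c (N.+1 - a)%N)).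
    by apply: eq_bigr => a _; ring.
  rewrite big_split /= big_split /= -rev -addrA; congr (_ + _).
    by rewrite mulr_sumr.
  rewrite -big_split /=.
  by apply: eq_bigr => a _; ring.
have step : n * (n + 1) * \sum_(1 <= m < N.+1) profile N.+1 m%:R * c m
  = N%:R * (N%:R + 1) * \sum_(1 <= m < N.+1) profile N m%:R * c m
    + \sum_(1 <= m < N.+1) 2 * n * (n ^+ 2 - n * m%:R + m%:R ^+ 2) * c m.
  rewrite !mulr_sumr -big_split /=; apply: eq_bigr => m _.
  by rewrite /profile /n -natr1; field.
have -> : n * (n + 1) * trigpoly c N.+1
  = n * (n + 1) * \sum_(1 <= m < N.+1) profile N.+1 m%:R * c m
    + n * (n + 1) * (n * (n + 1) * (n + 2) / 6 + profile N.+1 n * c N.+1).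
  by rewrite /trigpoly big_nat_recr //= -/n; ring.
rewrite step sum_quadratic IH /trigpoly.
by rewrite /profile /n -natr1; field.
Qed.

(** [frakB] interpolates affinely between its values at [t = 0], where all
    [u_n] have modulus [1] and all triple products are [1], and [t = 1/4]. *)
Lemma frakB_useqE (R : realType) (p theta : R) (N : nat) :
  let t := p * (1 - p) in
  frakB (useq p theta) N =
  (1 - 4 * t) *
    (\sum_(1 <= n < N.+1) n%:R ^+ 3
     + \sum_(1 <= a < N.+1) \sum_(1 <= b < N.+1 | (a + b <= N)%N)
        (a%:R + b%:R) * (a%:R ^+ 2 + a%:R * b%:R + b%:R ^+ 2))
  + t * linform (fun n => cos (n%:R * theta)) N.
Proof.
move=> t; rewrite /frakB /linform !mulrDr !mulr_sumr [RHS]addrACA.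
congr (_ + _); rewrite -big_split.
  by apply: eq_bigr => n _; rewrite useq_normc2 /t /=; ring.
apply: eq_bigr => a _; rewrite !mulr_sumr -big_split.
by apply: eq_bigr => b _; rewrite useq_triple /t /=; ring.
Qed.

(** * Closed form by summation by parts *)

(** Multiplying by [4 sin^2 phi = 2 - 2 cos (2 phi)] takes second differences of
    the coefficients.  Those of a quadratic extended evenly to [-N .. N] are
    constant except at [0], which yields the term in [b], and at the two ends,
    which yield the terms in [f]; the constant part is a Dirichlet kernel, hence
    the further factor [sin phi]. *)
Lemma quadratic_cos_sum (R : realType) (phi a b c : R) (N : nat) :
  let f := fun m : R => a + b * m + c * m ^+ 2 in
  let X := (2 * N%:R + 1) * phi in
  2 * sin phi ^+ 3 * (a + 2 * \sum_(1 <= m < N.+1) f m%:R * cos (m%:R * (2 * phi)))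
  = sin phi * (f (N%:R + 1) * cos (X - phi) - f N%:R * cos (X + phi))
    - b * sin phi - c * sin X.
Proof.
move=> f; have E := cos2sin2 phi.
cbv zeta; elim: N => [|N IH].
  rewrite big_nil /f !(mulr0, add0r, mul1r) subrr cos0 cosD; ring: E.
rewrite big_nat_recr //= [2 * (_ + _)]mulrDr addrA mulrDr IH -[N.+1%:R]natr1.
pose Z := (2 * N%:R + 2) * phi.
have -> : (2 * N%:R + 1) * phi - phi = Z - phi - phi by rewrite /Z; ring.
have -> : (2 * N%:R + 1) * phi + phi = Z by rewrite /Z; ring.
have -> : (2 * N%:R + 1) * phi = Z - phi by rewrite /Z; ring.
have -> : (N%:R + 1) * (2 * phi) = Z by rewrite /Z; ring.
have -> : (2 * (N%:R + 1) + 1) * phi - phi = Z by rewrite /Z; ring.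
have -> : (2 * (N%:R + 1) + 1) * phi + phi = Z + phi + phi by rewrite /Z; ring.
have -> : (2 * (N%:R + 1) + 1) * phi = Z + phi by rewrite /Z; ring.
rewrite !(sinB, sinD, cosB, cosD) /f; ring: E.
Qed.

Lemma trigpoly_closed (R : realType) (phi : R) (N : nat) :
  let x := (2 * N%:R + 1) * phi in
  let y := (2 * N%:R + 1) * sin phi in
  48 * sin phi ^+ 3 * trigpoly (fun m => cos (m%:R * (2 * phi))) N
  = y * (y ^+ 2 + 4 - sin phi ^+ 2) + 8 * y * cos phi * cos x
    + (5 * y ^+ 2 - 12 + 3 * sin phi ^+ 2) * sin x.
Proof.
move=> x y; have E := cos2sin2 phi.
have := @quadratic_cos_sum R phi (N%:R * (N%:R + 1) / 2) (- ((2 * N%:R + 1) / 3))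
  1 N.
have eqp m : N%:R * (N%:R + 1) / 2 + - ((2 * N%:R + 1) / 3) * m + 1 * m ^+ 2
  = profile N m :> R by rewrite /profile; ring.
rewrite /= !eqp /trigpoly; under eq_bigr do rewrite eqp.
rewrite -/x cosB cosD.
move: (\sum_(_ <= _ < _) _) => S H.
transitivity (4 * sin phi ^+ 3 * (N%:R * (N%:R + 1) * (2 * N%:R + 1))
  + 12 * (2 * sin phi ^+ 3 * (N%:R * (N%:R + 1) / 2 + 2 * S))).
  by field.
by rewrite {}H /profile /y; field: E.
Qed.

(** * Elementary bounds on sine, cosine and pi *)

Lemma cos_le (R : realType) (a b : R) :
  0 <= a -> a <= b -> b <= pi -> cos b <= cos a.
Proof.
move=> a0 ab bpi; by rewrite leNgt ltr_cos -?leNgt // in_itv /=; apply/andP; split; lra.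
Qed.

Lemma sin_mvt (R : realType) (a b : R) : a <= b ->
  exists2 c, a <= c <= b & sin b - sin a = cos c * (b - a).
Proof.
move=> ab; have [|c + E] := @MVT_segment R sin cos a b ab.
  exact/continuous_subspaceT/continuous_sin.
by rewrite in_itv /= => cab; exists c.
Qed.

Lemma sin_le_id (R : realType) (t : R) : 0 <= t -> sin t <= t.
Proof.
move=> t0; have [c _] := @sin_mvt R _ _ t0.
by rewrite sin0 !subr0 => ->; rewrite ler_piMl // cos_le1.
Qed.

Lemma sin_ge_mul_cos (R : realType) (t : R) :
  0 <= t -> t <= pi -> t * cos t <= sin t.
Proof.
move=> t0 tpi; have [c /andP[c0 ct]] := @sin_mvt R _ _ t0.
rewrite sin0 !subr0 => ->; rewrite mulrC ler_wpM2r //.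
by rewrite cos_le.
Qed.

(** Concavity: on [[0, a]] the sine lies above its chord.  The mean slopes over
    [[0, t]] and [[t, a]] are cosines at ordered points. *)
Lemma sin_chord (R : realType) (a t : R) :
  0 <= t -> t <= a -> a <= pi -> sin a * t <= a * sin t.
Proof.
move=> t0 ta api.
have [c /andP[c0 ct]] := @sin_mvt R _ _ t0; rewrite sin0 !subr0 => E1.
have [d /andP[td da] E2] := @sin_mvt R _ _ ta.
have cd : cos d <= cos c.
  by rewrite cos_le // ?(le_trans ct) // (le_trans da).
have -> : sin a = cos c * t + cos d * (a - t) by rewrite -E1 -E2; ring.
rewrite E1.
have H : 0 <= (cos c - cos d) * ((a - t) * t) by rewrite !mulr_ge0 ?subr_ge0.
lra.
Qed.

(** The triple angle formula makes [sin (pi/6)] a positive root of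
    [4 s^3 - 3 s + 1 = (s + 1) (2 s - 1)^2]. *)
Lemma sin_pi_div6 (R : realType) : sin (pi / 6) = 1 / 2 :> R.
Proof.
set t : R := pi / 6.
have s0 : 0 < sin t.
  have := pi_gt0 R => ?; apply: sin_gt0_pi; rewrite /t; apply/andP; split; lra.
have : sin (t + (t + t)) = 1 by rewrite -sin_pihalf; congr sin; rewrite /t; field.
rewrite sinD cosD (sinD t t) => H.
have E := cos2sin2 t.
have E3 : 3 * sin t - 4 * sin t ^+ 3 = 1 by rewrite -[RHS]H; ring: E.
have : (sin t + 1) * (2 * sin t - 1) ^+ 2 = 0.
  by transitivity (1 - (3 * sin t - 4 * sin t ^+ 3)); [ring | rewrite E3 subrr].
move/eqP; rewrite mulf_eq0 sqrf_eq0 => /orP[]/eqP; lra.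
Qed.

(** From [t <= tan t] at [t = pi / 12], where [tan t = 2 - sqrt 3]. *)
Lemma pi_le_13_div4 (R : realType) : pi <= 13 / 4 :> R.
Proof.
set t : R := pi / 12.
have p0 := pi_gt0 R; have := pi_ge2 R => p2.
have s6 := sin_pi_div6 R.
have c6 : cos (pi / 6 : R) = 2 * cos t ^+ 2 - 1.
  have -> : pi / 6 = t *+ 2 :> R by rewrite /t; field.
  by rewrite cos_mulr2n; ring.
have c60 : 0 <= cos (pi / 6 : R).
  by apply: cos_ge0_pihalf; apply/andP; split; lra.
have ct0 : 0 <= cos t.
  by apply: cos_ge0_pihalf; rewrite /t; apply/andP; split; lra.
have E6 := cos2sin2 (pi / 6 : R); rewrite s6 in E6.
have k : 19 / 22 <= cos (pi / 6 : R) by nra.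
have st : t * cos t <= sin t by apply: sin_ge_mul_cos; rewrite /t; lra.
have E := sin2cos2 t.
have t0 : 0 <= t by rewrite /t; lra.
have tc0 : 0 <= t * cos t by rewrite mulr_ge0.
have : (t * cos t) ^+ 2 <= sin t ^+ 2.
  by rewrite ler_sqr // nnegrE // (le_trans tc0).
rewrite exprMn E => H.
have C : 41 / 44 <= cos t ^+ 2 by lra.
have t1 : t <= 13 / 48 by nra.
by move: t1; rewrite /t; lra.
Qed.

(** The chord inequality on [[0, pi/6]], where the sine reaches [1/2]. *)
Lemma sin_ge_of_le_half (R : realType) (phi : R) :
  0 <= phi -> phi <= pi / 2 -> sin phi <= 1 / 2 -> 3 * phi <= pi * sin phi.
Proof.
move=> phi0 phi1 s_le; have pi0 := pi_gt0 R.
have phi6 : phi <= pi / 6.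
  rewrite leNgt; apply/negP => lt6.
  have : sin (pi / 6) < sin phi.
    by rewrite ltr_sin // in_itv /=; apply/andP; split; lra.
  by rewrite sin_pi_div6; lra.
have := @sin_chord R _ _ phi0 phi6.
by rewrite sin_pi_div6 => /(_ ltac:(lra)); lra.
Qed.

(** * Nonnegativity of the cosine polynomial *)

(** Cauchy-Schwarz: the oscillating part has amplitude [sqrt (B^2 + C^2)]. *)
Lemma cos_sin_combination_ge0 (R : realType) (A B C x : R) :
  0 <= A -> B ^+ 2 + C ^+ 2 <= A ^+ 2 -> 0 <= A + B * cos x + C * sin x.
Proof.
move=> A0 BC; have E := sin2cos2 x.
have : (B * cos x + C * sin x) ^+ 2 <= A ^+ 2.
  have -> : (B * cos x + C * sin x) ^+ 2
    = B ^+ 2 + C ^+ 2 - (B * sin x - C * cos x) ^+ 2 by ring: E.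
  by have := sqr_ge0 (B * sin x - C * cos x); lra.
rewrite -addrA; move: (B * _ + _) => v Hv; nra.
Qed.

(** The amplitude condition for the closed form, with [z = y^2], [u = s^2].  The
    difference of the two sides is a quadratic in [u] with leading coefficient
    [z - 9], whose values are [(z - 12) (z^2 - 5 z + 12)] at [u = 0] and
    [(z - 1) (z - 9)^2] at [u = 1]; it is their linear interpolation minus
    [(z - 9) u (1 - u)].  The bound [12] is the root at [u = 0]. *)
Lemma amplitude_poly_ge0 (R : realType) (z u : R) :
  12 <= z -> 0 <= u -> u <= 1 ->
  64 * z * (1 - u) + (5 * z - 12 + 3 * u) ^+ 2 <= z * (z + 4 - u) ^+ 2.
Proof.
move=> z12 u0 u1; rewrite -subr_ge0.
have -> : z * (z + 4 - u) ^+ 2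
    - (64 * z * (1 - u) + (5 * z - 12 + 3 * u) ^+ 2)
  = (1 - u) * ((z - 12) * (z ^+ 2 - 5 * z + 12))
    + u * ((z - 9) * ((z - 1) * (z - 9) - (1 - u))) by ring.
have q1 : 0 <= (z - 12) * (z - 12) by rewrite -expr2 sqr_ge0.
have q2 : 0 <= z ^+ 2 - 5 * z + 12 by lra.
have q3 : 0 <= (z - 1) * (z - 9) - (1 - u) by lra.
by rewrite addr_ge0 // !mulr_ge0 //; lra.
Qed.

(** The range [x >= pi] of the closed form, with [u = s^2], [k = cos phi],
    [cx = cos x] and [sx = sin x]: here [y >= 3], and [x - pi] is small
    because [x <= (pi/3) y], so [sx] cannot be very negative. *)
Lemma closed_form_ge0_beyond_pi (R : realFieldType) (y u k cx sx : R) :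
  3 <= y -> y ^+ 2 < 12 -> 0 <= u -> u <= 1 / 4 -> 0 <= k -> k <= 1 ->
  -1 <= cx -> - (13 / 4 * (y / 3 - 1)) <= sx ->
  0 <= y * (y ^+ 2 + 4 - u) + 8 * y * k * cx + (5 * y ^+ 2 - 12 + 3 * u) * sx.
Proof.
move=> y3 y12 u0 u4 k0 k1 cx1 sxL.
have y9 : 9 <= y ^+ 2.
  have : 3 * 3 <= y * y by rewrite ler_pM.
  rewrite expr2; lra.
have yU : y <= 7 / 2.
  rewrite leNgt; apply/negP => yb.
  have : (7 / 2) ^+ 2 < y ^+ 2 by rewrite !expr2 ltr_pM //; lra.
  lra.
have B : - (8 * y) <= 8 * y * k * cx.
  have B1 : 0 <= 8 * y * k * (cx + 1) by rewrite !mulr_ge0 //; lra.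
  have B2 : 0 <= 8 * y * (1 - k) by rewrite !mulr_ge0 //; lra.
  lra.
have C : (5 * y ^+ 2 - 12 + 3 * u) * - (13 / 4 * (y / 3 - 1))
  <= (5 * y ^+ 2 - 12 + 3 * u) * sx by rewrite ler_wpM2l //; lra.
(* Replaces the cubic term of the remaining polynomial, concave in y, by a
   quadratic that is tight at both ends of the range. *)
have D : 0 <= (y - 3) * (12 - y ^+ 2) by rewrite mulr_ge0 //; lra.
have D2 : u * y <= 1 / 4 * y by rewrite ler_wpM2r //; lra.
have D3 : (5 * y ^+ 2 - 12 + 3 * u) * (13 / 4 * (y / 3 - 1))
   <= (5 * y ^+ 2 - 12 + 3 / 4) * (13 / 4 * (y / 3 - 1)).
  by rewrite ler_wpM2r //; lra.
nra.
Qed.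

(** The range [pi/2 <= x <= pi], where [sx >= 0].  For [y^2 >= 4 + u] the cubic
    term absorbs the worst case [cx = -1]; for smaller [y] the angle [x] is close
    to [pi/2] and [cx] is far from [-1]. *)
Lemma closed_form_ge0_before_pi (R : realFieldType) (y u k cx sx : R) :
  3 / 2 <= y -> 0 <= u -> u <= 1 / 4 -> 0 <= k -> k <= 1 ->
  -1 <= cx -> - (13 / 4 * (y / 3 - 1 / 2)) <= cx -> 0 <= sx -> sx <= 1 ->
  0 <= y * (y ^+ 2 + 4 - u) + 8 * y * k * cx + (5 * y ^+ 2 - 12 + 3 * u) * sx.
Proof.
move=> ylow u0 u4 k0 k1 cx1 cxL sx0 sx1.
have y2 : 9 / 4 <= y ^+ 2.
  have : 3 / 2 * (3 / 2) <= y * y by rewrite ler_pM //; lra.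
  rewrite expr2; lra.
have [z4|z4] := leP (4 + u) (y ^+ 2).
  have B1 : 0 <= 8 * y * k * (cx + 1) by rewrite !mulr_ge0 //; lra.
  have B2 : 0 <= 8 * y * (1 - k) by rewrite !mulr_ge0 //; lra.
  have C : 0 <= (5 * y ^+ 2 - 12 + 3 * u) * sx by rewrite mulr_ge0 //; lra.
  have : 0 <= y * (y ^+ 2 - 4 - u) by rewrite mulr_ge0 //; lra.
  lra.
have yU : y <= 21 / 10.
  rewrite leNgt; apply/negP => yb.
  have : (21 / 10) ^+ 2 < y ^+ 2 by rewrite !expr2 ltr_pM //; lra.
  lra.
set d := 13 / 4 * (y / 3 - 1 / 2) in cxL.
have d0 : 0 <= d by rewrite /d; lra.
have B : - (8 * y * d) <= 8 * y * k * cx.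
  have B1 : 0 <= 8 * y * k * (cx + d) by rewrite !mulr_ge0 //; lra.
  have B2 : 0 <= 8 * y * (1 - k) * d by rewrite !mulr_ge0 //; lra.
  lra.
have C : - (3 / 4) <= (5 * y ^+ 2 - 12 + 3 * u) * sx.
  have C1 : 0 <= (5 * y ^+ 2 - 45 / 4 + 3 * u) * sx by rewrite mulr_ge0 //; lra.
  lra.
have D : 3 / 2 * (1 / 2) <= y * (y ^+ 2 + 4 - u - 8 * d).
  by rewrite ler_pM // /d; nra.
lra.
Qed.

(** The hypothesis [7 <= M] turns [y^2 < 12] into [s^2 < 12/49 < 1/4], that is
    [phi < pi/6]. *)
Lemma closed_form_ge0 (R : realType) (M phi : R) :
  let x := M * phi in let y := M * sin phi in
  7 <= M -> 0 <= phi -> phi <= pi / 2 -> pi / 2 <= x ->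
  0 <= y * (y ^+ 2 + 4 - sin phi ^+ 2) + 8 * y * cos phi * cos x
    + (5 * y ^+ 2 - 12 + 3 * sin phi ^+ 2) * sin x.
Proof.
move=> x y M7 phi0 phi1 xlow.
have pi0 := pi_gt0 R; have piU := pi_le_13_div4 R.
have s0 : 0 <= sin phi by apply: sin_ge0_pi; apply/andP; split; lra.
have k0 : 0 <= cos phi by apply: cos_ge0_pihalf; apply/andP; split; lra.
have M0 : 0 <= M by lra.
have y0 : 0 <= y by rewrite mulr_ge0.
have u0 : 0 <= sin phi ^+ 2 by exact: sqr_ge0.
have [z12|z12] := leP 12 (y ^+ 2).
  have u1 : sin phi ^+ 2 <= 1 by rewrite expr_le1 // sin_le1.
  apply: cos_sin_combination_ge0; first by rewrite mulr_ge0 //; lra.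
  have := @amplitude_poly_ge0 R _ _ z12 u0 u1.
  by rewrite !exprMn cos2sin2; lra.
have sy : 49 * sin phi ^+ 2 <= y ^+ 2.
  rewrite exprMn ler_wpM2r //.
  have : 7 * 7 <= M * M by rewrite ler_pM.
  rewrite expr2; lra.
have u4 : sin phi ^+ 2 <= 1 / 4 by lra.
have s_le : sin phi <= 1 / 2.
  rewrite leNgt; apply/negP => sb.
  have : (1 / 2) ^+ 2 < sin phi ^+ 2 by rewrite !expr2 ltr_pM //; lra.
  lra.
have xy : 3 * x <= pi * y.
  rewrite /x /y mulrCA [leRHS]mulrCA ler_wpM2l //.
  exact: sin_ge_of_le_half.
have ylow : 3 / 2 <= y.
  have : pi * (3 / 2) <= pi * y by lra.
  by rewrite ler_pM2l.
have k1 := cos_le1 phi; have cx1 := cos_geN1 x; have sx1 := sin_le1 x.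
have [xpi|xpi] := leP pi x.
  have y3 : 3 <= y.
    have : pi * 3 <= pi * y by lra.
    by rewrite ler_pM2l.
  apply: closed_form_ge0_beyond_pi => //.
  have : sin (x - pi) <= x - pi by rewrite sin_le_id // subr_ge0.
  rewrite sinB cospi sinpi => H.
  have : pi * (y / 3 - 1) <= 13 / 4 * (y / 3 - 1).
    by rewrite ler_wpM2r //; lra.
  lra.
apply: closed_form_ge0_before_pi => //.
  have : sin (x - pi / 2) <= x - pi / 2 by rewrite sin_le_id // subr_ge0.
  rewrite sinBpihalf => H.
  have : pi * (y / 3 - 1 / 2) <= 13 / 4 * (y / 3 - 1 / 2).
    by rewrite ler_wpM2r //; lra.
  lra.
by apply: sin_ge0_pi; apply/andP; split; lra.
Qed.

(** [cos (n a)] is a Chebyshev polynomial in [cos a]. *)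
Lemma cos_natmul_ext (R : realType) (a b : R) (n : nat) :
  cos a = cos b -> cos (n%:R * a) = cos (n%:R * b).
Proof.
move=> ab; suff [] : cos (n%:R * a) = cos (n%:R * b)
  /\ cos (n.+1%:R * a) = cos (n.+1%:R * b) by [].
elim: n => [|n [IH0 IH1]]; first by rewrite !mul0r !mul1r.
split=> //.
have step t : cos (n.+2%:R * t) = 2 * cos t * cos (n.+1%:R * t) - cos (n%:R * t).
  have -> : n.+2%:R * t = n.+1%:R * t + t by rewrite -[n.+2%:R]natr1; ring.
  have -> : n%:R * t = n.+1%:R * t - t by rewrite -[n.+1%:R]natr1; ring.
  by rewrite cosD cosB; ring.
by rewrite !step IH0 IH1 ab.
Qed.

Lemma profile_ge0 (R : realType) (N : nat) (m : R) :
  (1 <= N)%N -> 0 <= profile N m.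
Proof.
rewrite -(ler_nat R) /profile => N1.
have := sqr_ge0 (m - (2 * N%:R + 1) / 6 : R).
nra.
Qed.

Lemma trigpoly_ge0 (R : realType) (theta : R) (N : nat) :
  (1 <= N)%N -> 0 <= trigpoly (fun m => cos (m%:R * theta)) N.
Proof.
move=> N1; have [->|N_1] := eqVneq N 1%N.
  rewrite /trigpoly big_nat1 /profile !mul1r.
  by have := cos_geN1 theta; lra.
have [->|N_2] := eqVneq N 2%N.
  rewrite /trigpoly big_nat_recr //= big_nat1 /profile !mul1r.
  have -> : cos (2%:R * theta) = 2 * cos theta ^+ 2 - 1.
    by rewrite mulr_natl cos_mulr2n; ring.
  (* Completes the square in 22/3 c^2 + 7/3 c + 1/3 with c = cos theta. *)
  by have := sqr_ge0 (cos theta + 7 / 44); lra.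
have N3 : (3 <= N)%N by lia.
(* Folding theta into the interval from 0 to pi keeps all cos (m theta). *)
pose a := acos (cos theta).
have ct : -1 <= cos theta <= 1 by rewrite cos_geN1 cos_le1.
have a0 : 0 <= a by exact: acos_ge0.
have api : a <= pi by exact: acos_lepi.
have ca : cos theta = cos a by rewrite /a acosK.
have -> : trigpoly (fun m => cos (m%:R * theta)) N
  = trigpoly (fun m => cos (m%:R * (2 * (a / 2)))) N.
  rewrite /trigpoly; congr (_ + _); apply: eq_bigr => m _.
  by rewrite (@cos_natmul_ext _ _ a) //; congr (_ * cos (_ * _)); field.
have N3R : 3 <= N%:R :> R by rewrite (ler_nat R 3).
have pi0 := pi_gt0 R.
have [small|large] := leP (N%:R * a) (pi / 2).
  rewrite /trigpoly addr_ge0 // big_nat_cond sumr_ge0 // => m /andP[/andP[m1 mN] _].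
  rewrite mulr_ge0 ?profile_ge0 // cos_ge0_pihalf //.
  have mNR : m%:R <= N%:R :> R by rewrite ler_nat; lia.
  have m0 : 0 <= m%:R :> R by [].
  have -> : 2 * (a / 2) = a by field.
  have ma : m%:R * a <= N%:R * a by rewrite ler_wpM2r.
  have ma0 : 0 <= m%:R * a by rewrite mulr_ge0.
  by apply/andP; split; lra.
have s0 : 0 < sin (a / 2).
  have an0 : a != 0 by apply/eqP => a_0; move: large; rewrite a_0; lra.
  have : 0 < a by rewrite lt_def an0.
  by move=> ?; apply: sin_gt0_pi; apply/andP; split; lra.
have s3 : 0 < 48 * sin (a / 2) ^+ 3 by rewrite mulr_gt0 // exprn_gt0.
rewrite -(pmulr_rge0 _ s3) trigpoly_closed closed_form_ge0 //; lra.
Qed.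

Lemma frakB_useq_ge0 (R : realType) (p theta : R) (N : nat) :
  0 <= p -> p <= 1 -> 0 <= frakB (useq p theta) N.
Proof.
case: N => [|N] p0 p1; first by rewrite /frakB !big_nil addr0.
have t0 : 0 <= p * (1 - p) by rewrite mulr_ge0 // subr_ge0.
have t1 : 0 <= 1 - 4 * (p * (1 - p)) by have := sqr_ge0 (1 - 2 * p); lra.
rewrite frakB_useqE addr_ge0 // mulr_ge0 //; last first.
  by rewrite linformE !mulr_ge0 ?trigpoly_ge0 // addr_ge0.
rewrite addr_ge0 // sumr_ge0 // => a _.
by rewrite sumr_ge0 // => b _; rewrite mulr_ge0 ?addr_ge0 ?mulr_ge0 ?exprn_ge0.
Qed.

(** * Power series *)

(** All moduli and triple products are at most [1], and there are at most [N^2]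
    pairs of weight at most [6 N^3]. *)
Lemma frakB_useq_le (R : realType) (p theta : R) (N : nat) :
  0 <= p -> p <= 1 -> frakB (useq p theta) N <= 7 * N%:R ^+ 5.
Proof.
move=> p0 p1; have t0 : 0 <= p * (1 - p) by rewrite mulr_ge0 // subr_ge0.
have cos1 (a : nat) : 0 <= 1 - cos (a%:R * theta) by rewrite subr_ge0 cos_le1.
case: N => [|N]; first by rewrite /frakB !big_nil; lra.
set n := N.+1%:R : R.
have n1 : 1 <= n by rewrite /n (ler_nat R 1).
have le_n (a : nat) : (a < N.+2)%N -> a%:R <= n by rewrite /n ler_nat.
have sum_const (C : R) : \sum_(1 <= a < N.+2) C = n * C.
  by rewrite big_const_nat iter_addr_0 subn1 mulr_natl.
have S1 : \sum_(1 <= a < N.+2)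
    a%:R ^+ 3 * ComplexField.Normc.normc (useq p theta a) ^+ 2 <= n * n ^+ 3.
  rewrite -sum_const; apply: ler_sum_nat => a /andP[_ aN].
  rewrite -[leRHS]mulr1 ler_pM ?sqr_ge0 ?exprn_ge0 //.
    by rewrite lerXn2r ?nnegrE ?le_n //; lra.
  by rewrite useq_normc2 gerBl mulr_ge0 // mulr_ge0.
have S2 : \sum_(1 <= a < N.+2) \sum_(1 <= b < N.+2 | (a + b <= N.+1)%N)
      (a%:R + b%:R) * (a%:R ^+ 2 + a%:R * b%:R + b%:R ^+ 2)
      * complex.Re (useq p theta a * useq p theta b
                    * ((useq p theta (a + b)%N)^*)%C)
    <= n * (n * (6 * n ^+ 3)).
  rewrite -sum_const; apply: ler_sum_nat => a /andP[_ aN].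
  rewrite -sum_const big_mkcond; apply: ler_sum_nat => b /andP[_ bN].
  have R0 : 0 <= 6 * n ^+ 3 by rewrite mulr_ge0 // exprn_ge0 //; lra.
  case: ifP => // _.
  have a0 : 0 <= a%:R :> R by []. have b0 : 0 <= b%:R :> R by [].
  have an := le_n _ aN; have bn := le_n _ bN.
  have -> : 6 * n ^+ 3 = (n + n) * (n ^+ 2 + n * n + n ^+ 2) * 1 by ring.
  apply: le_trans (_ : (a%:R + b%:R) * (a%:R ^+ 2 + a%:R * b%:R + b%:R ^+ 2) * 1
     <= _); last first.
    rewrite !mulr1 ler_pM ?addr_ge0 ?mulr_ge0 ?exprn_ge0 ?lerD //.
    - by rewrite lerXn2r ?nnegrE //; lra.
    - by rewrite ler_pM.
    - by rewrite lerXn2r ?nnegrE //; lra.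
  rewrite ler_wpM2l ?mulr_ge0 ?addr_ge0 ?mulr_ge0 ?exprn_ge0 //.
  by rewrite useq_triple gerBl mulr_ge0 // !addr_ge0.
apply: le_trans (lerD S1 S2) _.
have -> : n * n ^+ 3 + n * (n * (6 * n ^+ 3)) = n ^+ 4 * 1 + 6 * n ^+ 5 by ring.
have -> : 7 * n ^+ 5 = n ^+ 4 * n + 6 * n ^+ 5 by ring.
by rewrite lerD2r ler_wpM2l // exprn_ge0 //; lra.
Qed.

(** In fact [(1 - q) n q^n <= (1 - q) (1 + q + ... + q^(n-1)) = 1 - q^n], since each
    power of [q] on the right is at least [q^n]. *)
Lemma natmul_expr_le (R : realFieldType) (q : R) (n : nat) :
  0 <= q -> q < 1 -> (1 - q) * (n%:R * q ^+ n) <= 1.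
Proof.
move=> q0 q1; have q1' : 0 <= 1 - q by lra.
have qn m : q ^+ m <= 1 by rewrite exprn_ile1 // ltW.
apply: le_trans (_ : 1 - q ^+ n <= _); last by rewrite gerBl exprn_ge0.
elim: n => [|n IH]; first by rewrite mul0r mulr0 subrr.
rewrite -natr1 exprS.
have H : 0 <= (1 - q) * (1 - q ^+ n) by rewrite mulr_ge0 // subr_ge0.
have H2 : q * ((1 - q) * (n%:R * q ^+ n)) <= q * (1 - q ^+ n) by rewrite ler_wpM2l.
have H3 : 0 <= (1 - q) * ((1 - q) * q ^+ n) by rewrite !mulr_ge0 ?exprn_ge0.
lra.
Qed.

(** Writing [x = q^(k+1)], each of [k] factors [q^n] absorbs one factor [n], and
    the remaining [q^n] gives a geometric majorant. *)
Lemma polynomial_power_series_cvg (R : realType) (B : nat -> R) (C x : R) (k : nat) :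
  0 < x -> x < 1 -> (forall n, 0 <= B n) -> (forall n, B n <= C * n%:R ^+ k) ->
  cvgn (series (fun n => B n * x ^+ n)).
Proof.
move=> x0 x1 B0 BC.
have [q [q0 q1 qE]] : exists q : R, [/\ 0 < q, q < 1 & x = q ^+ k.+1].
  exists (expR (ln x / k.+1%:R)); split; first exact: expR_gt0.
    by rewrite -expR0 ltr_expR pmulr_llt0 ?invr_gt0 // ln_lt0 // x0.
  by rewrite -expRM_natr divfK ?pnatr_eq0 // lnK.
have C0 : 0 <= C by have := le_trans (B0 1%N) (BC 1%N); rewrite expr1n mulr1.
have d0 : 0 < 1 - q by lra.
pose D := C * (1 - q)^-1 ^+ k.
apply: (@series_le_cvg R _ (geometric D q)).
- by move=> n; rewrite mulr_ge0 // exprn_ge0 // ltW.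
- by move=> n; rewrite /geometric /= !mulr_ge0 ?exprn_ge0 ?invr_ge0 // ltW.
- move=> n; rewrite /geometric /= /D.
  have -> : x ^+ n = (q ^+ n) ^+ k * q ^+ n.
    by rewrite qE -!exprM -exprD; congr (_ ^+ _); lia.
  rewrite mulrA ler_wpM2r ?exprn_ge0 ?(ltW q0) //.
  apply: le_trans (_ : C * n%:R ^+ k * (q ^+ n) ^+ k <= _).
    by rewrite ler_wpM2r // !exprn_ge0 // ltW.
  rewrite -mulrA -exprMn ler_wpM2l // lerXn2r ?nnegrE //.
  + by rewrite mulr_ge0 ?exprn_ge0 // ltW.
  + by rewrite invr_ge0 ltW.
  by rewrite -[leRHS]mul1r ler_pdivlMr // mulrC natmul_expr_le // ltW.
- by apply: is_cvg_geometric_series; rewrite ger0_norm // ltW.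
Qed.

Lemma abel_summation (R : comRingType) (B : nat -> R) (x : R) (M : nat) :
  B 0%N = 0 ->
  \sum_(1 <= N < M.+1) (B N - B N.-1) * x ^+ N
  = (1 - x) * (\sum_(1 <= N < M.+1) B N * x ^+ N) + x * (B M * x ^+ M).
Proof.
move=> B0; elim: M => [|M IH]; first by rewrite !big_nil B0; ring.
by rewrite big_nat_recr // [in RHS]big_nat_recr //= IH exprS; ring.
Qed.

Theorem theorem3p56 (R : realType) (p theta : R) (hp0 : 0 <= p) (hp1 : p <= 1) :
  (forall N : nat, (1 <= N)%N -> 0 <= frakB (useq p theta) N) /\
  (forall x : R, 0 < x -> x < 1 ->
     let SB := fun M : nat =>
       \sum_(1 <= N < M) frakB (useq p theta) N * x ^+ N in
     let Sb := fun M : nat =>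
       \sum_(1 <= N < M) frakb (useq p theta) N * x ^+ N in
     [/\ cvgn SB,
         cvgn Sb,
         limn Sb = (1 - x) * limn SB
       & 0 <= limn Sb]).
Proof.
have B_ge0 N : 0 <= frakB (useq p theta) N by exact: frakB_useq_ge0.
split=> [N _ //|x x0 x1 SB Sb].
have B_0 : frakB (useq p theta) 0 = 0 by rewrite /frakB !big_nil addr0.
have cvS : cvgn (series (fun n => frakB (useq p theta) n * x ^+ n)).
  apply: (@polynomial_power_series_cvg R _ 7 x 5) => // n.
  exact: frakB_useq_le.
have SBE : SB = series (fun n => frakB (useq p theta) n * x ^+ n).
  apply/funext => -[|M]; rewrite /SB /series /=; first by rewrite !big_nil.
  by rewrite [RHS]big_nat_recl // B_0 mul0r add0r big_add1.
have cvSB : cvgn SB by rewrite SBE.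
have SbE : Sb \o S = (fun M => (1 - x) * (SB \o S) M
                               + x * (frakB (useq p theta) M * x ^+ M)).
  apply/funext => M; exact: abel_summation.
have lim_Sb : Sb @ \oo --> (1 - x) * limn SB.
  have -> : (1 - x) * limn SB = (1 - x) * limn SB + x * 0.
    by rewrite mulr0 addr0.
  rewrite -(cvg_shiftS Sb) [X in X @ \oo](_ : _ = Sb \o S) // SbE.
  apply: cvgD; apply: cvgM; try exact: cvg_cst.
    by rewrite (cvg_shiftS SB).
  exact: cvg_series_cvg_0.
have limE := cvg_lim (@Rhausdorff R) lim_Sb.
split=> //; [by apply/cvg_ex; exists ((1 - x) * limn SB) | exact: limE |].
rewrite limE mulr_ge0 //; first lra.
apply: limr_ge => //; near=> M; rewrite /SB sumr_ge0 // => N _.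
by rewrite mulr_ge0 // exprn_ge0 // ltW.
Unshelve. all: by end_near.
Qed.
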